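(* Let $\mathcal K_{s,t}:\mathrm{NW}\to\mathrm{UC}_0$, $s\le t\in\mathbb{Q}$, be a family of random operators such that: (1) for all $f\in\mathrm{NW}$ and $s\le t\in\mathbb{Q}$, $\mathcal K_{s,t}f\overset{d}{=}\mathfrak h_{t-s}f$; (2) for any collection of disjoint intervals $[s_i,t_i]$, $i=1,\dots,k$, the operators $\mathcal K_{s_i,t_i}$, $i=1,\dots,k$, are independent; (3) for any $s\le r<t\in\mathbb{Q}$ and $f,g\in\mathrm{NW}$, if $g\le\mathcal K_{s,r}f$ then $\mathcal K_{r,t}g\le\mathcal K_{s,t}f$; (4) for all $s<t\in\mathbb{Q}$, $f\in\mathrm{NW}$, $c\in\mathbb{Q}$, $\mathcal K_{s,t}(f+c)=\mathcal K_{s,t}f+c$. Let $\mathcal L$ be a directed landscape (which exists under (1)-(4)) such that almost surely $\mathcal K_{s,t}g(x)=\sup_{y\in\mathbb{R}}[g(y)+\mathcal L(y,s;x,t)]$ for all $s<t\in\mathbb{Q}$, $g\in\mathrm{NW}$, $x\in\mathbb{R}$. Consider $f\in\mathrm{UC}_0$ satisfying $$\limsup_{z\to x,\,z\in\mathbb{Q}}f(z)=f(x)\qquad\text{for all }x\in\mathbb{R}.$$ Suppose that for some $s\le t\in\mathbb{Q}$ there is a random variable $\mathcal K_{s,t}f\in\mathrm{UC}_0$ such that $\mathcal K_{s,t}f\overset{d}{=}\mathfrak h_{t-s}f$ and $\mathcal K_{s,t}g\le\mathcal K_{s,t}f$ whenever $g\in\mathrm{NW}$, $g\le f$. Then, for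 this $s,t$ and $f$, almost surely $$\mathcal K_{s,t}f(x)=\sup_{y\in\mathbb{R}}\,[f(y)+\mathcal L(y,s;x,t)]\qquad\text{for all }x\in\mathbb{R}.$$
   Context: Function spaces. $\mathrm{UC}$ is the set of upper semicontinuous functions $\mathbb{R}\to\mathbb{R}\cup\{\pm\infty\}$, with the (compact, Polish) topology of the local Hausdorff metric $d(f,g)=d_H(E(\mathrm{hypo} f),E(\mathrm{hypo} g))$, where $\mathrm{hypo}(f)=\{(x,t)\in\mathbb{R}\times[-\infty,\infty]:t\le f(x)\}$, $E(x,s)=(x,e^{-|x|}s/(1+|s|))$ and $d_H$ is the Hausdorff metric. $\mathrm{UC}_0$ is the set of upper semicontinuous $f:\mathbb{R}\to\mathbb{R}\cup\{-\infty\}$ with $f\not\equiv-\infty$ and $\limsup_{x\to\pm\infty}f(x)/x^2\le0$. $\mathrm{NW}\subset\mathrm{UC}_0$ is the (countable) set of $f:\mathbb{R}\to\mathbb{R}\cup\{-\infty\}$ such that $\{x:f(x)>-\infty\}$ is a finite subset of $\mathbb{Q}$ and $f(\mathbb{R})\subset\mathbb{Q}\cup\{-\infty\}$. All random objects are defined on a common probability space. Directed landscape. $\mathbb{R}^4_\uparrow=\{(x,s;y,t)\in\mathbb{R}^4:s<t\}$; write $g_{s,t}(x,y)=g(x,s;y,t)$. The parabolic Airy line ensemble $(A_i)_{i\ge1}$ is the random sequence of continuous functions $A_1>A_2>\cdots$ on $\mathbb{R}$ such that $\{A_i(t)+t^2\}$ is determinantal with the extended Airy kernel $K(s,x;t,y)=\int_0^\infty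 e^{-\lambda(s-t)}\mathrm{Ai}(x+\lambda)\mathrm{Ai}(y+\lambda)\,d\lambda$ for $s\ge t$ and $-\int_{-\infty}^0e^{-\lambda(s-t)}\mathrm{Ai}(x+\lambda)\mathrm{Ai}(y+\lambda)\,d\lambda$ for $s<t$. For $x\le y$ let $A[(x,k)\to(y,1)]=\sup\sum_{i=1}^k\big(A_i(t_{i-1})-A_i(t_i)\big)$ over $x=t_k\le t_{k-1}\le\dots\le t_0=y$. The Airy sheet is the random continuous function $S:\mathbb{R}^2\to\mathbb{R}$, unique in law, such that $S(\cdot+c,\cdot+c)\overset{d}{=}S$ for all $c\in\mathbb{R}$, and $S$ can be coupled with $A$ so that $S(0,\cdot)=A_1$ and for all rational $x>0$, $y,z$ there is a random $K\in\mathbb{N}$ such that almost surely, for all $k\ge K$, $A[(-\sqrt{k/(2x)},k)\to(y,1)]-A[(-\sqrt{k/(2x)},k)\to(z,1)]=S(x,y)-S(x,z)$. A directed landscape is a random continuous function $\mathcal L:\mathbb{R}^4_\uparrow\to\mathbb{R}$ (unique in law) such that: (I) for disjoint time intervals $[t_i,s_i]$, $i=1,\dots,k$, the functions $\mathcal L_{t_i,s_i}$ are independent; (II) almost surely, for all $r<s<t$ and $x,y\in\mathbb{R}$, $\mathcal L_{r,t}(x,y)=\sup_{z\in\mathbb{R}}[\mathcal L_{r,s}(x,z)+\mathcal L_{s,t}(z,y)]$; (III) for $t\in\mathbb{R}$, $s>0$, $\mathcal L_{t,t+s^3}$ has the law of $(x,y)\mapsto sS(x/s^2,y/s^2)$.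 Convention: $\mathcal L(x,t;x,t)=0$ and $\mathcal L(x,t;y,t)=-\infty$ for $x\neq y$. KPZ fixed point. $(\mathfrak h_tf)_{t\ge0}$ denotes the KPZ fixed point started from $f$; its law is that of $\mathfrak h_0f=f$, $\mathfrak h_tf(x)=\sup_{y\in\mathbb{R}}[f(y)+\mathcal L(y,0;x,t)]$ for $t>0$, with $\mathcal L$ a directed landscape. *)

(* Defs.v *)
From HB Require Import structures.
From mathcomp Require Import all_boot all_order all_algebra.
From mathcomp Require Import all_classical all_reals all_analysis.
Set Implicit Arguments.
Unset Strict Implicit.
Unset Printing Implicit Defensive.
Import Order.TTheory GRing.Theory Num.Theory.
Import numFieldNormedType.Exports.
Local Open Scope classical_set_scope.
Local Open Scope ring_scope.

Section function_spaces.
Context {R : realType}.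
Implicit Types f g : R -> \bar R.

Definition upper_semicontinuous f := lower_semicontinuous (fun x => - f x)%E.

Definition UC : set (R -> \bar R) := [set f | upper_semicontinuous f].

Definition UC0 : set (R -> \bar R) := [set f |
  [/\ upper_semicontinuous f,
      (forall x, f x != +oo%E),
      (exists x, f x != -oo%E),
      (limf_esup (fun x : R => f x * ((x ^+ 2)^-1)%:E) (pinfty_nbhs R) <= 0)%E
    & (limf_esup (fun x : R => f x * ((x ^+ 2)^-1)%:E) (ninfty_nbhs R) <= 0)%E]].

Definition NW : set (R -> \bar R) := [set f |
  [/\ UC0 f,
      finite_set [set x | f x != -oo%E],
      [set x | f x != -oo%E] `<=` @rational R
    & forall x, f x != -oo%E -> exists q : rat, f x = (ratr q)%:E]].

Definition hypo f : set (R * \bar R) := [set p | (p.2 <= f p.1)%E].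

(* [contract s] is s / (1 + |s|), extended by 1 at +oo and by -1 at -oo. *)
Definition squash (p : R * \bar R) : R * R :=
  (p.1, expR (- `|p.1|) * contract p.2).

Definition euclid (a b : R * R) : R :=
  Num.sqrt ((a.1 - b.1) ^+ 2 + (a.2 - b.2) ^+ 2).

Definition dist_to (a : R * R) (B : set (R * R)) : \bar R :=
  ereal_inf [set (euclid a b)%:E | b in B].

Definition hausdorff_dist (A B : set (R * R)) : \bar R :=
  Order.max (ereal_sup [set dist_to a B | a in A])
            (ereal_sup [set dist_to b A | b in B]).

Definition UC_dist f g : \bar R :=
  hausdorff_dist (squash @` hypo f) (squash @` hypo g).

Definition UC_open : set (set (R -> \bar R)) := [set U | U `<=` UC /\
  forall f, U f -> exists2 e : R, 0 < e &
    forall g, UC g -> (UC_dist f g < e%:E)%E -> U g].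

Definition UC_borel : set (set (R -> \bar R)) := <<s UC, UC_open >>.

End function_spaces.

(* The sigma-algebra on real functions generated by the evaluations; its trace
   on the continuous functions on R^2 is their Borel sigma-algebra for locally
   uniform convergence. *)
Definition cylinder {R : realType} (I : Type) : set (set (I -> R)) :=
  <<s [set (fun g : I -> R => g i) @^-1` B | i in [set: I] &
           B in (measurable : set (set R))] >>.

Definition random_element d (T : measurableType d) (E : Type)
    (S : set E) (G : set (set E)) (X : T -> E) :=
  (forall w, S (X w)) /\ (forall B, G B -> measurable (X @^-1` B)).

(* Equality of laws on the sigma-algebra G; the two variables may live on
   different probability spaces. *)
Definition eq_law {R : realType} (E : Type) (G : set (set E))
    d (T : measurableType d) (P : probability T R) (X : T -> E)
    d' (T' : measurableType d') (P' : probability T' R) (Y : T' -> E) :=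
  forall B, G B -> P (X @^-1` B) = P' (Y @^-1` B).

(* Meant for sigma-algebras F i: as these contain the whole space, the product
   rule for the full family implies it for every subfamily. *)
Definition independent_salgebras {R : realType} d (T : measurableType d)
    (P : probability T R) (k : nat) (F : 'I_k -> set (set T)) :=
  forall A : 'I_k -> set T, (forall i, F i (A i)) ->
    P (\bigcap_(i in [set: 'I_k]) A i) = (\prod_(i < k) P (A i))%E.

Definition random_continuous_plane {R : realType} d (T : measurableType d)
    (S : T -> R * R -> R) :=
  random_element [set g : R * R -> R | continuous g] (@cylinder R (R * R)) S.

Section airy.
Context {R : realType}.
Local Notation mu := (@lebesgue_measure R).

(* Improper integral: the integrand is not Lebesgue integrable on [0, +oo[. *)
Definition Ai (x : R) : R := pi^-1 *
  lim ((fun M : R => \int[mu]_(u in `[0, M]) cos (u ^+ 3 / 3 + x * u))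
       @ +oo).

Definition extended_airy_kernel (s x t y : R) : R :=
  if t <= s then
    \int[mu]_(l in `[0, +oo[) (expR (- l * (s - t)) * Ai (x + l) * Ai (y + l))
  else
    - \int[mu]_(l in `]-oo, 0]) (expR (- l * (s - t)) * Ai (x + l) * Ai (y + l)).

(* Iterated integral of F over the product of the sets in Bs. *)
Fixpoint iterated_integral (Bs : seq (set R)) (F : seq R -> R) : R :=
  if Bs is B :: Bs' then
    \int[mu]_(x in B) iterated_integral Bs' (fun xs => F (x :: xs))
  else F [::].

(* For all times t_1, ..., t_n (repetitions allowed), the factorial moment
   measures of the points {(t, X i t)} have density
   det [K (t_i, x_i; t_j, x_j)]: the expected number of n-tuples of distinct
   points, the j-th one being at time t_j and in B_j, is the integral of that
   determinant over B_1 x ... x B_n. *)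
Definition determinantal d (T : measurableType d) (P : probability T R)
    (X : nat -> R -> T -> R) (K : R -> R -> R -> R -> R) :=
  forall (n : nat) (t : n.-tuple R) (B : n.-tuple (set R)),
    (forall j, measurable (tnth B j) /\ bounded_set (tnth B j)) ->
    (\int[P]_w counting
       [set i : {ffun 'I_n -> nat} |
         injective (fun j => (tnth t j, i j)) /\
         forall j, tnth B j (X (i j) (tnth t j) w)] =
     (iterated_integral B (fun x : seq R =>
        \det (\matrix_(i < n, j < n) K (tnth t i) x`_i (tnth t j) x`_j)))%:E)%E.

(* Lines are numbered from 0: [A i] is the (i+1)-st line. *)
Definition parabolic_airy_line_ensemble d (T : measurableType d)
    (P : probability T R) (A : nat -> R -> T -> R) :=
  [/\ (forall i t, measurable_fun [set: T] (A i t)),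
      (forall i w, continuous (fun t : R => A i t w)),
      (forall i t w, A i.+1 t w < A i t w)
    & determinantal P (fun i t w => A i t w + t ^+ 2) extended_airy_kernel].

(* a[(x, k) -> (y, 1)], the supremum over y = t_0 >= t_1 >= ... >= t_k = x. *)
Definition last_passage (a : nat -> R -> R) (x : R) (k : nat) (y : R) : R :=
  sup [set r | exists t : nat -> R,
    [/\ t 0%N = y, t k = x, (forall i, (i < k)%N -> t i.+1 <= t i)
      & r = \sum_(i < k) (a i (t i) - a i (t i.+1))]].

Definition airy_sheet d (T : measurableType d) (P : probability T R)
    (S : T -> R * R -> R) :=
  [/\ random_continuous_plane S,
      (forall c : R, eq_law (@cylinder R (R * R))
         P (fun w z => S w (z.1 + c, z.2 + c)) P S)
    & exists (d' : measure_display) (T' : measurableType d')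
        (P' : probability T' R) (S' : T' -> R * R -> R)
        (A : nat -> R -> T' -> R),
      [/\ random_continuous_plane S' /\ eq_law (@cylinder R (R * R)) P' S' P S,
          parabolic_airy_line_ensemble P' A,
          {ae P', forall w, forall y, S' w (0, y) = A 0%N y w}
        & forall x y z : rat, 0 < x ->
          exists2 K : T' -> nat, measurable_fun [set: T'] K &
          {ae P', forall w, forall k : nat, (K w <= k)%N ->
            let x0 := - Num.sqrt (k%:R / (2 * ratr x)) in
            last_passage (fun i u => A i u w) x0 k (ratr y)
            - last_passage (fun i u => A i u w) x0 k (ratr z)
            = S' w (ratr x, ratr y) - S' w (ratr x, ratr z)}]].

End airy.

Section landscape.
Context {R : realType}.

Definition R4up : set ((R * R) * (R * R)) := [set p | p.1.2 < p.2.2].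

(* L w ((x, s), (y, t)) is only meaningful for s < t. *)
Definition slice d (T : measurableType d) (L : T -> (R * R) * (R * R) -> R)
    (s t : R) : T -> R * R -> R := fun w z => L w ((z.1, s), (z.2, t)).

Definition directed_landscape d (T : measurableType d) (P : probability T R)
    (L : T -> (R * R) * (R * R) -> R) :=
  [/\ (forall p, R4up p -> measurable_fun [set: T] (fun w => L w p))
        /\ (forall w, {within R4up, continuous (L w)}),
      (forall (k : nat) (t s : 'I_k -> R), (forall i, t i < s i) ->
         trivIset [set: 'I_k] (fun i => `[t i, s i]%classic) ->
         independent_salgebras P (fun i : 'I_k =>
           [set slice L (t i) (s i) @^-1` B | B in @cylinder R (R * R)])),
      {ae P, forall w, forall r s t x y : R, r < s -> s < t ->
         (L w ((x, r), (y, t)))%:E =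
         ereal_sup [set (L w ((x, r), (z, s)) + L w ((z, s), (y, t)))%:E
                   | z in [set: R]]}
    & exists (d' : measure_display) (T' : measurableType d')
        (P' : probability T' R) (S : T' -> R * R -> R),
        airy_sheet P' S /\
        forall t s : R, 0 < s ->
          eq_law (@cylinder R (R * R)) P (slice L t (t + s ^+ 3))
            P' (fun w z => s * S w (z.1 / s ^+ 2, z.2 / s ^+ 2))].

(* L(x, s; y, t) for s <= t, with the convention for s = t. *)
Definition landscape_ext (l : (R * R) * (R * R) -> R) (x s y t : R) : \bar R :=
  if s < t then (l ((x, s), (y, t)))%:E else if x == y then 0%E else -oo%E.

Definition variational (l : (R * R) * (R * R) -> R) (s t : R)
    (f : R -> \bar R) (x : R) : \bar R :=
  ereal_sup [set f y + landscape_ext l y s x t | y in [set: R]]%E.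

Definition kpz_fixed_point (l : (R * R) * (R * R) -> R) (t : R)
    (f : R -> \bar R) : R -> \bar R :=
  if t == 0 then f else variational l 0 t f.

(* X has the law of the KPZ fixed point at time t started from f. The law of a
   directed landscape being unique, "every landscape" below means "the law of
   the landscape". The variational formula is in UC only almost surely, so the
   law is that of a UC-valued variable h almost surely equal to it. *)
Definition has_kpz_law d (T : measurableType d) (P : probability T R)
    (X : T -> R -> \bar R) (t : R) (f : R -> \bar R) :=
  forall (d' : measure_display) (T' : measurableType d')
    (P' : probability T' R) (L : T' -> (R * R) * (R * R) -> R),
  directed_landscape P' L ->
  exists h : T' -> R -> \bar R,
    [/\ random_element UC UC_borel h,
        {ae P', forall w, h w = kpz_fixed_point (L w) t f}
      & eq_law UC_borel P X P' h].

(* The sigma-algebra generated by the random operator K : NW -> UC0. *)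
Definition operator_salgebra d (T : measurableType d)
    (K : (R -> \bar R) -> T -> R -> \bar R) : set (set T) :=
  <<s [set K f @^-1` B | f in NW & B in UC_borel] >>.

End landscape.

(* Main.v *)
(* Testing against point masses at rational points, whose values approach f from
   below, gives Kf >= V, where V is the variational formula driven by L: the
   condition on f and the continuity of L reduce the supremum over all y to
   rational y. By stationarity in time, the shift of L by s is again a
   directed landscape, so Kf and V also have the same law. Two upper
   semicontinuous random functions with the same law, one dominating the other,
   agree almost surely: the countably many events "the supremum over ]a, b[
   exceeds c" have equal probabilities and are nested, and they determine the
   function. For s = t, V = f is deterministic and the same events are used. *)

Require Import Defs.
From HB Require Import structures.
From mathcomp Require Import all_boot all_order all_algebra.
From mathcomp Require Import all_classical all_reals all_analysis.
From mathcomp Require Import lra.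
Import Order.TTheory GRing.Theory Num.Theory.
Import numFieldNormedType.Exports.
Local Open Scope classical_set_scope.
Local Open Scope ring_scope.

(** * Almost sure statements *)

Section almost_sure.
Context {R : realType} {d : measure_display} {T : measurableType d}.
Context (P : probability T R).

Lemma ae_forall_countable (I : countType) (Q : I -> T -> Prop) :
  (forall i, {ae P, forall w, Q i w}) -> {ae P, forall w, forall i, Q i w}.
Proof.
move=> aeQ.
have : {ae P, forall w, forall n : nat, forall i, unpickle n = Some i -> Q i w}.
  apply: ae_foralln => n; case: (unpickle n) => [i|].
    by apply: filterS (aeQ i) => w Qw j [<-].
  exact: aeW.
by apply: filterS => w Qw i; apply: (Qw (pickle i)); rewrite pickleK.
Qed.

(** Up to a null set [A] lies in [B], so their intersection has the probability of [A], hence of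
    [B]. Probabilities being finite, subtraction shows that [B] minus [A] is null. *)
Lemma ae_converse (A B : set T) : measurable A -> measurable B ->
  P A = P B -> {ae P, forall w, A w -> B w} -> {ae P, forall w, B w -> A w}.
Proof.
move=> mA mB PAB aeAB.
have PAD : P (A `\` B) = 0%E.
  apply/negligibleP; first exact: measurableD.
  apply: negligibleS aeAB => w [Aw nBw] /= /(_ Aw); exact: nBw.
have PI : P (B `&` A) = P B.
  rewrite -PAB -[in RHS](setDUK (@subIsetr _ B A)) measureU //.
  - by rewrite setDIr setDv setU0; move: PAD => /= ->; rewrite adde0.
  - exact: measurableI.
  - by apply: measurableD => //; exact: measurableI.
  - by rewrite setDE setICA setICr setI0.
suff : P.-negligible (B `\` A).
  by apply: negligibleS => w /= /not_implyP.
apply/negligibleP; first exact: measurableD.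
rewrite measureD //; last by rewrite ltey_eq fin_num_measure.
by move: PI => /= ->; rewrite subee // fin_num_measure.
Qed.

End almost_sure.

(** * Events that determine an upper semicontinuous function *)

Section upper_semicontinuous.
Context {R : realType}.
Implicit Types f g : R -> \bar R.

(** The supremum over []a, b[] exceeds [c] exactly when some value does. Membership in [UC] is
    included because [UC_open] consists of subsets of [UC]. *)
Definition hits (a b c : R) : set (R -> \bar R) :=
  [set f | UC f /\ exists2 x, a < x < b & (c%:E < f x)%E].

Lemma euclid_ge (p q : R * R) :
  `|p.1 - q.1| <= euclid p q /\ `|p.2 - q.2| <= euclid p q.
Proof.
by split; rewrite -sqrtr_sqr ler_wsqrtr // ?lerDl ?lerDr sqr_ge0.
Qed.

Lemma hits_open (a b c : R) : UC_open (hits a b c).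
Proof.
split=> [f [] //|f [UCf [x /andP[ax xb] cfx]]].
(* Multiplying by [expR `|p.1|] undoes the weight in [squash], so that
   [hits a b c f] says that the image of [hypo f] meets the open set [V]. *)
pose V : set (R * R) :=
  [set p | [/\ a < p.1, p.1 < b & contract c%:E < p.2 * expR `|p.1|]].
have squash_V (p : R * \bar R) :
    V (Defs.squash p) <-> a < p.1 < b /\ (c%:E < p.2)%E.
  rewrite /V /Defs.squash /= mulrAC -expRD addNr expR0 mul1r.
  rewrite -(lt_contract c%:E).
  by split=> [[-> -> ->]|[/andP[-> ->] ->]].
have /nbhs_ballP[e /= e0 eV] : nbhs (Defs.squash (x, f x)) V.
  have : V (Defs.squash (x, f x)) by apply/squash_V; rewrite ax xb.
  case=> ax1 xb1 cx; near=> p; split; near: p.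
  - by apply: (cvgr_gt _ cvg_fst).
  - by apply: (cvgr_lt _ cvg_fst).
  - apply: (cvgr_gt _ _ _ cx); apply: cvgM; first exact: cvg_snd.
    apply: continuous_cvg; first exact: continuous_expR.
    apply: cvg_norm; exact: cvg_fst.
exists e => // g UCg; rewrite /UC_dist /hausdorff_dist gt_max => /andP[dfg _].
split=> //.
(* The half of the Hausdorff distance taken from [f] to [g] yields a point [q] of [hypo g] whose
   image is still in [V]; then [g q.1] is at least [q.2], which exceeds [c]. *)
have : (dist_to (Defs.squash (x, f x)) (Defs.squash @` hypo g) < e%:E)%E.
  apply: le_lt_trans dfg; apply: ereal_sup_ubound.
  exists (Defs.squash (x, f x)) => //.
  by exists (x, f x) => //=; rewrite /hypo /=.
move=> /ereal_inf_lt[_ [_ [q qg <-] <-]]; rewrite lte_fin => de.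
have [d1 d2] := euclid_ge (Defs.squash (x, f x)) (Defs.squash q).
have /squash_V[qab cq] : V (Defs.squash q).
  by apply: eV; split; exact: le_lt_trans de.
by exists q.1 => //; exact: lt_le_trans qg.
Unshelve. all: by end_near. Qed.

Lemma hits_borel (a b c : R) : UC_borel (hits a b c).
Proof. by apply: sub_sigma_algebra; exact: hits_open. Qed.

Lemma usc_nbhs f x a : UC f -> (f x < a%:E)%E ->
  exists2 e : R, 0 < e & forall y, `|x - y| < e -> (f y < a%:E)%E.
Proof.
move=> uf fxa; have [|V] := uf x (- a); first by rewrite EFinN lteN2.
move=> /nbhs_ballP[e /= e0 eV] Va; exists e => // y /eV/Va.
by rewrite EFinN lteN2.
Qed.

Lemma rat_dense_ereal (u v : \bar R) : (u < v)%E ->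
  exists q : rat, (u < (ratr q)%:E < v)%E.
Proof.
case: u v => [u| |] [v| |] //=.
- by rewrite lte_fin => /rat_in_itvoo[q]; rewrite in_itv/= -!lte_fin; exists q.
- move=> _; have [q] : exists q : rat, ratr q \in `]u, u + 1[.
    by apply: rat_in_itvoo; rewrite ltrDl.
  by rewrite in_itv/= => /andP[uq _]; exists q; rewrite lte_fin uq ltry.
- move=> _; have [q] : exists q : rat, ratr q \in `]v - 1, v[.
    by apply: rat_in_itvoo; rewrite gtrBl.
  by rewrite in_itv/= => /andP[_ qv]; exists q; rewrite lte_fin qv ltNyr.
- by exists 0; rewrite ltNyr ltry.
Qed.

(** If [g x < c < f x] with [c] rational, semicontinuity keeps [g] below [c] on a rational interval
    around [x], an interval on which [f] exceeds [c] at [x]. *)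
Lemma hits_le f g : UC f -> UC g ->
  (forall a b c : rat, hits (ratr a) (ratr b) (ratr c) f ->
                       hits (ratr a) (ratr b) (ratr c) g) ->
  forall x, (f x <= g x)%E.
Proof.
move=> UCf UCg fg x; rewrite leNgt; apply/negP => /rat_dense_ereal[c].
move=> /andP[gc cf]; have [e e0 ge] := usc_nbhs _ _ _ UCg gc.
have [a] : exists a : rat, ratr a \in `]x - e, x[.
  by apply: rat_in_itvoo; rewrite gtrBl.
have [b] : exists b : rat, ratr b \in `]x, x + e[.
  by apply: rat_in_itvoo; rewrite ltrDl.
rewrite !in_itv/= => /andP[xb be] /andP[ea ax].
have [_ [y /andP[ay yb]]] : hits (ratr a) (ratr b) (ratr c) g.
  by apply: fg; split=> //; exists x => //; rewrite ax xb.
by rewrite ltNge ltW// ge// ltr_norml; lra.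
Qed.

(** * Point masses as test functions, and reduction to rational starting points *)

Definition point_mass (q r : rat) : R -> \bar R :=
  fun x => if x == ratr q then (ratr r)%:E else -oo%E.

Lemma limf_esup_point_mass_le0 (q r : rat) (F : set (set R)) :
  F [set x : R | x != ratr q] ->
  (limf_esup (fun x : R => point_mass q r x * ((x ^+ 2)^-1)%:E) F <= 0)%E.
Proof.
move=> Fq; apply: ge_ereal_inf; eexists.
  by exists [set x : R | x != ratr q].
apply: ge_ereal_sup => _ [x /= /negbTE xq <-].
(* At [x = 0] the inverse is [0] by convention and the product is [0] rather than [-oo]; the sign
   argument covers both cases. *)
by rewrite /point_mass xq mule_le0_ge0 ?leNye// lee_fin invr_ge0 sqr_ge0.
Qed.

Lemma point_mass_NW (q r : rat) : NW (point_mass q r).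
Proof.
have supp x : point_mass q r x != -oo%E -> x = ratr q.
  by rewrite /point_mass; case: (eqVneq x (ratr q)) => // _; rewrite eqxx.
have pmq : point_mass q r (ratr q) = (ratr r)%:E by rewrite /point_mass eqxx.
split.
- split.
  + move=> x a; have [->|xq] := eqVneq x (ratr q).
      rewrite pmq => ar; exists setT; first exact: filterT.
      by move=> y _; rewrite /point_mass; case: ifP => // _; exact: ltry.
    move=> _; exists [set y | y != ratr q].
      by apply: open_nbhs_nbhs; split => //; exact: open_neq.
    by move=> y /negbTE yq; rewrite /point_mass yq ltry.
  + by move=> x; rewrite /point_mass; case: ifP.
  + by exists (ratr q); rewrite pmq.
  + apply: limf_esup_point_mass_le0; near=> x.
    by rewrite /= gt_eqF//; near: x; apply: nbhs_pinfty_gt; rewrite num_real.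
  + apply: limf_esup_point_mass_le0; near=> x.
    by rewrite /= lt_eqF//; near: x; apply: nbhs_ninfty_lt; rewrite num_real.
- by apply: sub_finite_set (finite_set1 (ratr q)) => x /= /supp.
- by move=> x /= /supp ->; exists q.
- by move=> x /supp ->; exists r.
Unshelve. all: by end_near. Qed.

(** If the term at a real [y] exceeded [k], some rational [c < f y] would still give [k < c + l]. By
    continuity this persists near [y], where the condition on [f] provides a rational [q] with
    [f q > c]. *)
Lemma variational_le (l : (R * R) * (R * R) -> R) (s t : R) f (x : R)
    (k : \bar R) :
  s < t -> continuous (fun z => l ((z, s), (x, t))) ->
  (forall y, f y != +oo%E) ->
  (forall y, limf_esup f (within (@rational R) (nbhs y)) = f y) ->
  (forall q : rat, (f (ratr q) + (l ((ratr q, s), (x, t)))%:E <= k)%E) ->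
  (variational l s t f x <= k)%E.
Proof.
move=> st cl fpoo frat fk; apply: ge_ereal_sup => _ [y _ <-].
rewrite /landscape_ext st leNgt; apply/negP => kfl.
have : (k - (l ((y, s), (x, t)))%:E < f y)%E by rewrite lteBlDr.
move=> /rat_dense_ereal[c /andP[kc cf]].
have lc : \forall z \near y, (k < (ratr c + l ((z, s), (x, t)))%:E)%E.
  move: kc; rewrite lteBlDr// -EFinD.
  case: k {fk kfl} => [k| |] //=; last first.
    by move=> _; apply: (filterS _ filterT) => z _; exact: ltNyr.
  rewrite lte_fin => kc.
  have cv : (fun z => ratr c + l ((z, s), (x, t))) @ y -->
      ratr c + l ((y, s), (x, t)).
    by apply: cvgD; [exact: cvg_cst|exact: cl].
  by apply: filterS (cvgr_gt _ cv _ kc) => z; rewrite lte_fin.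
have : ((ratr c)%:E < limf_esup f (within (@rational R) (nbhs y)))%E.
  by rewrite frat.
pose V := [set z | rational z /\ (k < (ratr c + l ((z, s), (x, t)))%:E)%E].
have VF : within (@rational R) (nbhs y) V.
  by apply: filterS lc => z kz rz; split.
(* [limf_esup] is an infimum over the sets of the filter, hence at most the supremum of [f] over
   [V]; so [f] exceeds [c] somewhere in [V]. *)
move=> /lt_le_trans/(_ (ereal_inf_lbound (ex_intro2 _ _ V VF erefl))).
move=> /ereal_sup_gt[_ [_ [[q _ <-] kz] <-]] cfq.
have := lt_le_trans kz _; rewrite EFinD.
move=> /(_ _ (leeD2r _ (ltW cfq)))/lt_le_trans/(_ (fk q)).
by rewrite ltxx.
Qed.

End upper_semicontinuous.

Lemma continuous_pair_at (X U V : topologicalType) (f : X -> U) (g : X -> V) x :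
  {for x, continuous f} -> {for x, continuous g} ->
  {for x, continuous (fun z => (f z, g z))}.
Proof. by move=> cf cg; exact: cvg_pair. Qed.

(** * Equality in law, and time shifts of the landscape *)

Section laws.
Context {R : realType} {d : measure_display} {T : measurableType d}.
Context (P : probability T R).

(** Equal laws let [ae_converse] reverse each implication; rational parameters keep the exceptional
    sets countable in number, and [hits_le] concludes. *)
Lemma ae_eq_of_law (X Y : T -> R -> \bar R) :
  random_element UC UC_borel X -> random_element UC UC_borel Y ->
  eq_law UC_borel P X P Y ->
  (forall a b c : R, {ae P, forall w, hits a b c (Y w) -> hits a b c (X w)}) ->
  {ae P, forall w, forall x, X w x = Y w x}.
Proof.
move=> [UCX mX] [UCY mY] XY YX.
have aeXY : {ae P, forall w, forall i : rat * rat * rat,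
    hits (ratr i.1.1) (ratr i.1.2) (ratr i.2) (X w) <->
    hits (ratr i.1.1) (ratr i.1.2) (ratr i.2) (Y w)}.
  apply: ae_forall_countable => -[[a b] c] /=.
  have B := hits_borel (ratr a) (ratr b) (ratr c : R).
  have := ae_converse P _ _ (mY _ B) (mX _ B) (esym (XY _ B)) (YX _ _ _).
  by apply: filterS2 (YX (ratr a) (ratr b) (ratr c)) => w yx xy; split.
apply: filterS aeXY => w H x; apply/le_anti/andP; split.
  by apply: hits_le => // a b c /(H (a, b, c)).
by apply: hits_le => // a b c /(H (a, b, c)).
Qed.

Definition time_shift (s : R) (l : (R * R) * (R * R) -> R)
    (p : (R * R) * (R * R)) : R :=
  l ((p.1.1, p.1.2 + s), (p.2.1, p.2.2 + s)).

(** Openness turns continuity within [R4up] into continuity at each of its points. *)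
Lemma R4up_open : open (@R4up R).
Proof.
have -> : @R4up R = (fun p => p.2.2 - p.1.2) @^-1` [set r | 0 < r].
  by apply/seteqP; split => p /=; rewrite /R4up /= subr_gt0.
apply: open_comp; last exact: open_gt.
move=> p _; apply: cvgB.
  exact: (cvg_comp _ _ cvg_snd cvg_snd).
exact: (cvg_comp _ _ cvg_fst cvg_snd).
Qed.

Lemma directed_landscape_continuous (L : T -> (R * R) * (R * R) -> R) w p :
  directed_landscape P L -> R4up p -> {for p, continuous (L w)}.
Proof.
move=> [[_ cL] _ _ _] Rp; move: (cL w).
by rewrite (continuous_open_subspace _ R4up_open); apply; rewrite inE.
Qed.

(** Each defining property is invariant under a common translation of both times. The shift is
    needed because [kpz_fixed_point] starts at time [0]. *)
Lemma directed_landscape_time_shift (s0 : R)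
    (L : T -> (R * R) * (R * R) -> R) :
  directed_landscape P L -> directed_landscape P (fun w => time_shift s0 (L w)).
Proof.
move=> dL; have [[mL cL] iL mcL [d' [T' [P' [S [SS sL]]]]]] := dL; split.
- split=> [p Rp|w]; first by apply: mL; rewrite /R4up /= ltrD2r.
  rewrite (continuous_open_subspace _ R4up_open) => p; rewrite inE => Rp.
  have Rp' : R4up ((p.1.1, p.1.2 + s0), (p.2.1, p.2.2 + s0)).
    by rewrite /R4up /= ltrD2r.
  pose h1 (v : R * R) := (v.1, v.2 + s0).
  have ch1 : continuous h1.
    move=> v; apply: continuous_pair_at; first exact: cvg_fst.
    by apply: cvgD; [exact: cvg_snd|exact: cvg_cst].
  have ch : {for p, continuous (fun q => (h1 q.1, h1 q.2))}.
    apply: continuous_pair_at.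
    + by apply: (@continuous_comp _ _ _ fst h1); [exact: cvg_fst|exact: ch1].
    + by apply: (@continuous_comp _ _ _ snd h1); [exact: cvg_snd|exact: ch1].
  apply: (@continuous_comp _ _ _ _ (L w) p ch).
  exact: (directed_landscape_continuous _ _ _ dL Rp').
- move=> k t s ts tI.
  apply: (iL k (fun i => t i + s0) (fun i => s i + s0)) => [i|].
    by rewrite ltrD2r.
  move=> i j _ _ [x /= []]; rewrite !in_itv/= => /andP[? ?] /andP[? ?].
  apply: tI => //; exists (x - s0).
  by split; rewrite /= in_itv/=; apply/andP; split; lra.
- apply: filterS mcL => w mc r s t x y rs st.
  by rewrite /time_shift (mc _ (s + s0)) ?ltrD2r.
- exists d', T', P', S; split=> // t s s_gt0.
  have := sL (t + s0) s s_gt0; rewrite addrAC; exact.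
Qed.

Lemma variational_time_shift (l : (R * R) * (R * R) -> R) (s t : R) :
  variational (time_shift s l) 0 (t - s) = variational l s t.
Proof.
apply/funext => f; apply/funext => x.
rewrite /variational /landscape_ext /time_shift /= add0r subrK.
by rewrite subr_gt0.
Qed.

Lemma variational_diag (l : (R * R) * (R * R) -> R) (s : R) (f : R -> \bar R)
    x :
  variational l s s f x = f x.
Proof.
apply/le_anti/andP; split.
  apply: ge_ereal_sup => _ [y _ <-]; rewrite /landscape_ext ltxx.
  (* Adding [-oo] gives [-oo] even to [+oo], so the terms with [y] different from [x] never
     contribute. *)
  by case: eqP => [->|_]; rewrite ?adde0// addeNy leNye.
apply: ereal_sup_ubound; exists x => //.
by rewrite /landscape_ext ltxx eqxx adde0.
Qed.

End laws.

(** * Domination together with equality in law *)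

Theorem corollary1p5 (R : realType) (d : measure_display)
  (T : measurableType d) (P : probability T R)
  (K : rat -> rat -> (R -> \bar R) -> T -> R -> \bar R)
  (K_random : forall (s t : rat) (f : R -> \bar R), s <= t -> NW f ->
     random_element UC0 UC_borel (K s t f))
  (K_law : forall (f : R -> \bar R) (s t : rat), NW f -> s <= t ->
     has_kpz_law P (K s t f) (ratr (t - s)) f)
  (K_indep : forall (k : nat) (s t : 'I_k -> rat), (forall i, s i <= t i) ->
     trivIset [set: 'I_k]
       (fun i => `[ratr (s i) : R, ratr (t i) : R]%classic) ->
     independent_salgebras P (fun i : 'I_k => operator_salgebra (K (s i) (t i))))
  (K_mono : forall (s r t : rat) (f g : R -> \bar R),
     s <= r -> r < t -> NW f -> NW g ->
     {ae P, forall w, (forall x, (g x <= K s r f w x)%E) ->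
                      forall x, (K r t g w x <= K s t f w x)%E})
  (K_shift : forall (s t : rat) (f : R -> \bar R) (c : rat), s < t -> NW f ->
     {ae P, forall w, forall x : R,
        K s t (fun y => f y + (ratr c)%:E)%E w x
        = (K s t f w x + (ratr c)%:E)%E})
  (L : T -> (R * R) * (R * R) -> R)
  (L_landscape : directed_landscape P L)
  (K_L : {ae P, forall w, forall (s t : rat) (g : R -> \bar R) (x : R),
     s < t -> NW g ->
     K s t g w x = variational (L w) (ratr s) (ratr t) g x})
  (f : R -> \bar R) (f_UC0 : UC0 f)
  (f_rat : forall x : R,
     limf_esup f (within (@rational R) (nbhs x)) = f x)
  (s t : rat) (s_le_t : s <= t)
  (Kf : T -> R -> \bar R)
  (Kf_random : random_element UC0 UC_borel Kf)
  (Kf_law : has_kpz_law P Kf (ratr (t - s)) f)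
  (Kf_mono : forall g : R -> \bar R, NW g -> (forall x, (g x <= f x)%E) ->
     {ae P, forall w, forall x, (K s t g w x <= Kf w x)%E}) :
  {ae P, forall w, forall x : R,
     Kf w x = variational (L w) (ratr s) (ratr t) f x}.
Proof.
have UC_UC0 g : UC0 g -> UC g by case.
have KfUC : random_element UC UC_borel Kf.
  by case: Kf_random => K0 mK; split=> // w; exact/UC_UC0.
have {}s_le_t : ratr s <= ratr t :> R by rewrite ler_rat.
(* [Kf_law] applies to every landscape. Taking the shift of [L], which lives on [T], makes [h]
   comparable with [Kf] outcome by outcome. *)
have [h [hUC hE hlaw]] :=
  Kf_law _ _ _ _ (directed_landscape_time_shift P (ratr s) L L_landscape).
have hV : {ae P, forall w, h w = variational (L w) (ratr s) (ratr t) f}.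
  apply: filterS hE => w ->; rewrite /kpz_fixed_point raddfB /=.
  case: eqP => [/eqP|_]; last by rewrite variational_time_shift.
  rewrite subr_eq0 => /eqP ->; apply/funext => x.
  by rewrite variational_diag.
suff hKf : forall a b c : R,
    {ae P, forall w, hits a b c (h w) -> hits a b c (Kf w)}.
  apply: filterS2 (ae_eq_of_law P Kf h KfUC hUC hlaw hKf) hV => w e1 e2 x.
  by rewrite e1 e2.
move=> a b c.
have mhits (X : T -> R -> \bar R) : random_element UC UC_borel X ->
    measurable (X @^-1` hits a b c).
  by case=> _; apply; exact: hits_borel.
(* [K_L] concerns [s < t]. For [s = t], if [f] is in [hits a b c] then the event for [h] has
   probability one, hence so does that for [Kf]; otherwise the implication is almost surely
   vacuous. *)
have [st|ts] := ltP (ratr s : R) (ratr t); last first.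
  have hf : {ae P, forall w, h w = f}.
    apply: filterS hV => w ->; apply/funext => x.
    have -> : ratr t = ratr s :> R by apply/le_anti/andP.
    exact: variational_diag.
  have [fhit|fnhit] := pselect (hits a b c f); last first.
    by apply: filterS hf => w ->.
  apply: (ae_converse P _ _ (mhits _ KfUC) (mhits _ hUC)).
    exact: hlaw (hits_borel a b c).
  by apply: filterS hf => w /= ->.
have KfV : {ae P, forall w, forall x,
    (variational (L w) (ratr s) (ratr t) f x <= Kf w x)%E}.
  (* Rational positions and heights are countable, so one null set serves all point masses below
     [f]. *)
  have mono : {ae P, forall w, forall i : rat * rat,
      ((ratr i.2)%:E <= f (ratr i.1))%E -> forall x,
      (K s t (point_mass i.1 i.2) w x <= Kf w x)%E}.
    apply: ae_forall_countable => -[q r] /=.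
    have [rf|rf] := boolP ((ratr r)%:E <= f (ratr q))%E; last exact: aeW.
    have := Kf_mono _ (point_mass_NW q r) _.
    have pf x : (point_mass q r x <= f x)%E.
      by rewrite /point_mass; case: eqP => [->|_]; rewrite ?leNye.
    by move=> /(_ pf); apply: filterS.
  apply: filterS2 mono K_L => w mw kw x.
  have [_ fpoo _ _ _] := f_UC0.
  apply: variational_le => //.
    move=> y.
    have cy : {for y,
        continuous (fun z : R => ((z, ratr s : R), (x, ratr t : R)))}.
      apply: continuous_pair_at; last exact: cvg_cst.
      by apply: continuous_pair_at; [exact: cvg_id|exact: cvg_cst].
    apply: (@continuous_comp _ _ _ _ (L w) y cy).
    exact: (directed_landscape_continuous P L w _ L_landscape).
  move=> q; rewrite leNgt; apply/negP; rewrite -lteBlDr//.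
  (* A height [r] strictly between [Kf w x - L] and [f (ratr q)] gives a point mass below [f] whose
     image under [K s t] exceeds [Kf w x] at [x], a contradiction. *)
  move=> /rat_dense_ereal[r /andP[kr rf]].
  have := mw (q, r) (ltW rf) x.
  have st_rat : s < t by rewrite -(ltr_rat R).
  rewrite (kw _ _ _ _ st_rat (point_mass_NW q r)).
  move=> /(le_trans (ereal_sup_ubound (ex_intro2 _ _ (ratr q) I erefl))).
  by rewrite /point_mass eqxx /landscape_ext st leNgt -lteBlDr// kr.
apply: filterS2 KfV hV => w kv hv [_ [x abx cx]]; split; first by case: KfUC.
by exists x => //; apply: lt_le_trans cx _; rewrite hv.
Qed.
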